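(* For every fixed natural number $k$ there is a polynomial-time algorithm that, given a graph $G$ together with a partition of its vertex set into $k$ sets $A_1,\ldots,A_k$ each of which is a clique of $G$, decides whether the vertex set of $G$ can be partitioned into triangles.
   Context: Such a graph $G$ is exactly the complement of a $k$-partite graph with the given color classes; the color classes are part of the input. *)

(* Defs.v *)
From mathcomp Require Import all_boot.
Set Implicit Arguments. Unset Strict Implicit. Unset Printing Implicit Defensive.

Inductive Sym := S0 | S1 | Sep.

Inductive Mv := MvL | MvR | MvS.

Record TM := mkTM {
  tm_state : finType;
  tm_alpha : finType;
  tm_blank : tm_alpha;
  tm_embed : Sym -> tm_alpha;
  tm_start : tm_state;
  tm_acc : tm_state;
  tm_rej : tm_state;
  tm_delta : tm_state -> tm_alpha -> tm_state * tm_alpha * Mv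
}.

(** Configuration: state, tape left of the head (reversed), tape from the head
    rightwards (the head reads the first cell; empty = blank). *)
Definition config (M : TM) : Type :=
  (tm_state M * seq (tm_alpha M) * seq (tm_alpha M))%type.

Definition tm_step (M : TM) (cf : config M) : config M :=
  let: (q, l, r) := cf in
  if (q == tm_acc M) || (q == tm_rej M) then cf else
  let: (q', b, m) := tm_delta q (head (tm_blank M) r) in
  let r' := b :: behead r in
  match m with
  | MvL => match l with
           | x :: l' => (q', l', x :: r')
           | [::] => (q', [::], r')
           end
  | MvR => (q', b :: l, behead r)
  | MvS => (q', l, r')
  end.

Definition tm_init (M : TM) (w : seq Sym) : config M :=
  (tm_start M, [::], map (tm_embed M) w).

Definition tm_run (M : TM) (t : nat) (w : seq Sym) : config M :=
  iter t (@tm_step M) (tm_init M w).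

Definition tm_state_of (M : TM) (cf : config M) : tm_state M := cf.1.1.

Definition encode (n k : nat) (adj : rel 'I_n) (c : 'I_n -> 'I_k) : seq Sym :=
  flatten [seq [seq (if adj i j then S1 else S0) | j <- enum 'I_n]
                 ++ Sep :: nseq (nat_of_ord (c i)) S1 ++ [:: Sep]
          | i <- enum 'I_n].

Definition simple_graph (n : nat) (adj : rel 'I_n) : Prop :=
  (forall x y, adj x y = adj y x) /\ (forall x, adj x x = false).

(** The classes A_i = c^{-1}(i), i < k, (which partition the vertex set) are
    all cliques of the graph. *)
Definition classes_are_cliques (n k : nat) (adj : rel 'I_n) (c : 'I_n -> 'I_k)
  : Prop :=
  forall x y, c x = c y -> x != y -> adj x y.

Definition triangle_partitionable (n : nat) (adj : rel 'I_n) : Prop :=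
  exists P : {set {set 'I_n}},
    partition P [set: 'I_n] /\
    forall B, B \in P -> #|B| = 3 /\ {in B &, forall x y, x != y -> adj x y}.

Definition decides_triangle_partition_in_poly_time (k : nat) (M : TM)
  (c d : nat) : Prop :=
  forall (n : nat) (adj : rel 'I_n) (lab : 'I_n -> 'I_k),
    simple_graph adj -> classes_are_cliques adj lab ->
    let w := encode adj lab in
    let q := tm_state_of (tm_run M (c * size w ^ d + c) w) in
    (q = tm_acc M \/ q = tm_rej M) /\
    (q = tm_acc M <-> triangle_partitionable adj).

(* Main.v *)
From HB Require Import structures.
Require Import Defs.
From mathcomp Require Import all_boot zify.

Set Implicit Arguments. Unset Strict Implicit. Unset Printing Implicit Defensive.

(** Three vertex-disjoint triangles with the same number of vertices in every
    class can be replaced by three triangles each lying inside a class.  Hence a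
    triangle partition exists iff there are at most [2 * 4^k] disjoint triangles
    such that the number of uncovered vertices of every class is divisible by 3:
    keep at most two triangles of each colour profile, and cut the rest of each
    clique into triples.

    For fixed [k] this condition is expressed by a formula of first-order logic
    with counting, whose variables are positions of the input word.  Such a
    formula is evaluated by nested loops over boundedly many heads on the word;
    a Turing machine keeps the heads as marks on the tape and performs each
    elementary operation in one sweep to the right and one back. *)

(** * Head programs on a Turing machine *)

(** Transports the finite type structure of [option bool] to [Sym], so that tape cells carrying
    letters form a finite alphabet. *)
Definition sym_code (a : Sym) : option bool :=
  match a with S0 => Some false | S1 => Some true | Sep => None end.
Definition sym_decode (o : option bool) : Sym :=
  match o with Some false => S0 | Some true => S1 | None => Sep end.
Lemma sym_codeK : cancel sym_code sym_decode. Proof. by case. Qed.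
HB.instance Definition _ := Finite.copy Sym (can_type sym_codeK).

(** [Init] is reserved for the start of the machine; [code_ok] excludes it from programs.
    [Read x None] tests whether head [x] has run past the last letter. *)
Inductive op :=
  | Init
  | Zero of nat
  | Inc of nat
  | Read of nat & option Sym
  | Lt of nat & nat
  | Eql of nat & nat.

Record instr := Ins { iop : op; itrue : nat; ifalse : nat }.

Definition store := nat -> nat.

Definition upd (s : store) (x v : nat) : store :=
  fun y => if y == x then v else s y.

Section Semantics.
Variable w : seq Sym.

(** Heads live on the positions [0] to [size w], the last being the blank after the word; [Inc]
    stops there. *)
Definition op_store (o : op) (s : store) : store :=
  match o with
  | Init => fun=> 0
  | Zero x => upd s x 0
  | Inc x => upd s x (minn (s x).+1 (size w))
  | _ => s
  end.

Definition op_result (o : op) (s : store) : bool :=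
  match o with
  | Init => true
  | Zero _ | Inc _ => false
  | Read x a => onth w (s x) == a
  | Lt x y => s x < s y
  | Eql x y => s x == s y
  end.

Definition bounded (s : store) := forall x, s x <= size w.

Lemma op_store_bounded o s : bounded s -> bounded (op_store o s).
Proof.
move=> bs x; case: o => [|y|y|y a|y z|y z] //=; rewrite /upd; case: eqP => // _.
exact: geq_minr.
Qed.

Inductive run (code : seq instr) : nat -> nat * store -> nat * store -> Prop :=
  | run0 c : run code 0 c c
  | runS n pc s o t f c : onth code pc = Some (Ins o t f) ->
      run code n (if op_result o s then t else f, op_store o s) c ->
      run code n.+1 (pc, s) c.

Lemma run_cat code n1 n2 c1 c2 c3 :
  run code n1 c1 c2 -> run code n2 c2 c3 -> run code (n1 + n2) c1 c3.
Proof. by move=> r12; elim: r12 c3 => {n1 c1 c2} // *; apply: runS; eauto. Qed.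

End Semantics.

Definition op_heads (o : op) : seq nat :=
  match o with
  | Init => [::]
  | Zero x | Inc x | Read x _ => [:: x]
  | Lt x y | Eql x y => [:: x; y]
  end.

(** * Simulation of head programs by sweeps over the tape *)

Section Machine.
Variables (m : nat) (code : seq instr).

Definition cell := (bool * option Sym * {ffun 'I_m -> bool})%type.

Definition marked (x : nat) (a : cell) : bool :=
  if insub x is Some y then a.2 y else false.

Definition set_mark (x : nat) (b : bool) (a : cell) : cell :=
  (a.1, [ffun y : 'I_m => if y == x :> nat then b else a.2 y]).

(* One cell of the left-to-right sweep that executes an operation; the boolean
   is the carry of the sweep, and after the last cell it is the result. *)
Definition sweep (o : op) (b : bool) (a : cell) : bool * cell :=
  match o with
  | Init => (true, if b then a else (true, a.1.2, [ffun=> true]))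
  | Zero x => (b, set_mark x a.1.1 a)
  | Inc x => let here := marked x a in let last := a.1.2 == None in
      (here && ~~ last, set_mark x (b || here && last) a)
  | Read x c => (if marked x a then a.1.2 == c else b, a)
  | Lt x y => (if marked x a then false else if marked y a then true else b, a)
  | Eql x y => (if marked x a then marked y a else b, a)
  end.

Definition fetch (pc : nat) : instr := nth (Ins Init 0 0) code pc.

(* A state is (program counter, carry, returning to the left end?).  The
   counters L, L+1, L+2, with L the length of the code, stand for acceptance,
   rejection and the start; [fetch] gives the initialising sweep at L+2. *)
Definition mstate := ('I_(size code).+3 * bool * bool)%type.

(** The first cell without a letter ends the sweep: there the carry selects the next counter and the
    head turns back. The flag in the leftmost cell ends the return. *)
Definition mdelta (q : mstate) (a : cell) : mstate * cell * Mv :=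
  let: (pc, b, back) := q in
  if back then
    if a.1.1 then ((pc, false, false), a, MvS) else ((pc, false, true), a, MvL)
  else
    let: (b', a') := sweep (iop (fetch pc)) b a in
    if a.1.2 == None then
      ((inord (if b' then itrue (fetch pc) else ifalse (fetch pc)), false, true),
       a', MvL)
    else ((pc, b', false), a', MvR).

Definition mblank : cell := (false, None, [ffun=> false]).

Definition at_pc (pc : nat) : mstate := (inord pc, false, false).

Definition machine : TM :=
  @mkTM mstate cell mblank (fun a => (false, Some a, [ffun=> false]))
    (at_pc (size code).+2) (at_pc (size code)) (at_pc (size code).+1) mdelta.

Variable w : seq Sym.
Let N := size w.

(** Cell [N] is the blank after the word, kept explicitly because heads may be marked there. *)
Definition mcell (s : store) (i : nat) : cell :=
  (i == 0, onth w i, [ffun y : 'I_m => s y == i]).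

Definition mconfig (pc : nat) (s : store) : config machine :=
  (at_pc pc, [::], mkseq (mcell s) N.+1).

Lemma marked_mcell s i x : x < m -> marked x (mcell s i) = (s x == i).
Proof. by move=> xm; rewrite /marked insubT /= ffunE. Qed.

Lemma onth_None i : (onth w i == None) = (N <= i).
Proof. by rewrite leqNgt -onthTE; case: (onth w i). Qed.

(** The carry with which a sweep enters cell [i], in closed form. For [Inc] it moves the mark one
    cell to the right; for [Lt x y] it is true when [y] has been passed and [x] has not been met at
    or after it. *)
Definition carry (o : op) (s : store) (i : nat) : bool :=
  match o with
  | Init => 0 < i
  | Zero _ => false
  | Inc x => ((s x).+1 == i) && (i <= N)
  | Read x c => (s x < i) && (onth w (s x) == c)
  | Lt x y => (s y < i) && ~~ ((s y <= s x) && (s x < i))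
  | Eql x y => (s x < i) && (s x == s y)
  end.

Lemma carry_result o s : bounded w s -> carry o s N.+1 = op_result w o s.
Proof.
move=> bs; case: o => [|x|x|x c|x y|x y] //=; rewrite ?(ltnS, bs) ?andbF //=.
  by rewrite ltnn andbF.
by rewrite andbT ltnNge.
Qed.

Lemma sweep_mcell o s i : i <= N -> bounded w s ->
  all (fun x => x < m) (op_heads o) -> o <> Init ->
  sweep o (carry o s i) (mcell s i) = (carry o s i.+1, mcell (op_store w o s) i).
Proof.
move=> iN bs; case: o => [|x|x|x c|x y|x y] //=.
- move=> _ _; congr (_, (_, _)); apply/ffunP=> y; rewrite !ffunE /upd.
  by case: (y == x :> nat); rewrite // eq_sym.
- move=> /andP[xm _] _; rewrite marked_mcell // onth_None /=.
  congr (_, (_, _)); first by lia.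
  apply/ffunP=> y; rewrite !ffunE /upd; case: (y == x :> nat) => //.
  by have := bs x; rewrite -/N; lia.
- move=> /andP[xm _] _; rewrite marked_mcell //=; congr pair.
  case: (ltngtP (s x) i) => [lt|gt|->]; last by rewrite ltnS leqnn.
    by rewrite ltnS ltnW.
  by rewrite ltnS leqNgt gt.
- move=> /and3P[xm ym _] _; rewrite !marked_mcell //; congr pair.
  by case: eqP => ?; [|case: eqP => ?]; lia.
- move=> /and3P[xm ym _] _; rewrite !marked_mcell //; congr pair.
  by case: eqP => ?; lia.
Qed.

(** The accepting and rejecting states are not returning ones, so after a jump to their counters the
    machine still completes its way back before it halts. *)
Lemma machine_step (pc : 'I_(size code).+3) b back l r :
  back || (pc != size code :> nat) && (pc != (size code).+1 :> nat) ->
  @tm_step machine ((pc, b, back), l, r) =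
  let: (q', a, mv) := mdelta (pc, b, back) (head mblank r) in
  let r' := a :: behead r in
  match mv with
  | MvL => match l with
           | x :: l' => (q', l', x :: r')
           | [::] => (q', [::], r')
           end
  | MvR => (q', a :: l, behead r)
  | MvS => (q', l, r')
  end.
Proof.
move=> H; rewrite /tm_step /= !xpair_eqE.
case: ifP => //; case: back H => /=; first by rewrite !andbF.
rewrite !andbT -!(inj_eq val_inj) /= !inordK; [|lia|lia].
by case/andP=> /negbTE-> /negbTE->.
Qed.

Lemma mkseqS_rev (f : nat -> cell) j : rev (mkseq f j.+1) = f j :: rev (mkseq f j).
Proof. by rewrite mkseqS rev_rcons. Qed.

Section Sweep.
Variables (pc : 'I_(size code).+3) (r : seq cell) (B : nat -> bool).
Variable new : nat -> cell.
Hypotheses (pc_acc : pc != size code :> nat) (pc_rej : pc != (size code).+1 :> nat).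
Hypothesis size_r : size r <= N.+1.
Hypothesis r_sym : forall i, i <= N -> (nth mblank r i).1.2 = onth w i.
Hypothesis new_left : forall i, (new i).1.1 = (i == 0).
Hypothesis B0 : B 0 = false.
Hypothesis sweepE : forall i, i <= N ->
  sweep (iop (fetch pc)) (B i) (nth mblank r i) = (B i.+1, new i).

Lemma run_right j : j <= N ->
  iter j (@tm_step machine) ((pc, false, false), [::], r) =
  ((pc, B j, false), rev (mkseq new j), drop j r).
Proof.
elim: j => [|j IH] jN; first by rewrite drop0 B0.
rewrite iterS IH; last exact: ltnW.
rewrite machine_step /=; last by rewrite pc_acc.
rewrite -nth0 nth_drop addn0 (sweepE (ltnW jN)) r_sym; last exact: ltnW.
by rewrite onth_None leqNgt jN /= mkseqS_rev -[behead _]drop1 drop_drop add1n.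
Qed.

Lemma run_left (p : 'I_(size code).+3) i : i <= N ->
  exists2 t, t <= i.+1 &
    iter t (@tm_step machine)
      ((p, false, true), rev (mkseq new i), map new (iota i (N.+1 - i))) =
    ((p, false, false), [::], mkseq new N.+1).
Proof.
elim: i => [|i IH] iN.
  by exists 1 => //; rewrite [iter _ _ _]machine_step //= new_left.
have [|t le_t Ht] := IH; first exact: ltnW.
exists t.+1 => //; rewrite iterSr machine_step //.
have ->: N.+1 - i.+1 = (N - i.+1).+1 by lia.
rewrite /= new_left mkseqS_rev -Ht.
by have ->: N.+1 - i = (N - i.+1).+2 by lia.
Qed.

(** There are [N.+1] steps to the right and at most [N.+1] back. Allowing [r] to be shorter than
    [N.+1] covers the initial tape, whose closing blank is only read by default. *)
Lemma run_sweep :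
  let target := if B N.+1 then itrue (fetch pc) else ifalse (fetch pc) in
  exists2 t, t <= N.*2.+2 &
    iter t (@tm_step machine) ((pc, false, false), [::], r) =
    (at_pc target, [::], mkseq new N.+1).
Proof.
move=> target.
have [t le_t Ht] := @run_left (inord target) N.-1 (leq_pred N).
exists (t + N.+1); first by lia.
rewrite iterD iterS (run_right (leqnn N)) machine_step /=; last by rewrite pc_acc.
rewrite -nth0 nth_drop addn0 (sweepE (leqnn N)) r_sym // onth_None leqnn.
have ->: behead (drop N r) = [::].
  by rewrite -[behead _]drop1 drop_drop add1n drop_oversize.
rewrite -/target -Ht; congr (iter t _ _).
(* On the empty word the turn takes place on the leftmost cell, where a left move stays put; this is
   why the return starts from [N.-1]. *)
case: N => [|n] //=; rewrite mkseqS_rev.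
by have ->: n.+2 - n = 2 by lia.
Qed.

End Sweep.

Lemma machine_instr pc s o t f : onth code pc = Some (Ins o t f) ->
  bounded w s -> all (fun x => x < m) (op_heads o) -> o <> Init ->
  exists2 n, n <= N.*2.+2 &
    iter n (@tm_step machine) (mconfig pc s) =
    mconfig (if op_result w o s then t else f) (op_store w o s).
Proof.
move=> Hpc bs Ho HI.
have pcL : pc < size code by rewrite -onthTE Hpc.
have vpc : (inord pc : 'I_(size code).+3) = pc :> nat by rewrite inordK //; lia.
have fpc : fetch (inord pc : 'I_(size code).+3) = Ins o t f.
  by rewrite /fetch vpc (onth_nth _ _ _ _ Hpc).
have nthE i : i <= N -> nth mblank (mkseq (mcell s) N.+1) i = mcell s i.
  by move=> iN; rewrite nth_mkseq.
have [] := @run_sweep (inord pc) (mkseq (mcell s) N.+1) (carry o s) (mcell (op_store w o s)).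
- by rewrite vpc; lia.
- by rewrite vpc; lia.
- by rewrite size_mkseq.
- by move=> i iN; rewrite nthE.
- by [].
- by case: o {Hpc Ho fpc} HI => //= *; rewrite ltn0 ?andbF.
- by move=> i iN; rewrite nthE // fpc /= sweep_mcell.
by move=> n le_n Hn; exists n => //; rewrite Hn fpc carry_result.
Qed.

Lemma machine_init :
  exists2 n, n <= N.*2.+2 & tm_run machine n w = mconfig 0 (fun=> 0).
Proof.
have vpc : (inord (size code).+2 : 'I_(size code).+3) = (size code).+2 :> nat.
  by rewrite inordK.
have fpc : fetch (inord (size code).+2 : 'I_(size code).+3) = Ins Init 0 0.
  by rewrite /fetch vpc nth_default //; lia.
set r : seq cell := map (tm_embed machine) w.
have nthE i : nth mblank r i = (false, onth w i, [ffun=> false]).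
  by rewrite /r; elim: w i => [|a v IH] [|i] //=; exact: IH.
have [] := @run_sweep (inord (size code).+2) r (carry Init (fun=> 0)) (mcell (fun=> 0)).
- by rewrite vpc; lia.
- by rewrite vpc; lia.
- by rewrite size_map.
- by move=> i iN; rewrite nthE.
- by [].
- by [].
- by move=> [|i] iN; rewrite nthE fpc.
by rewrite fpc => n le_n Hn; exists n.
Qed.

Definition code_ok :=
  all (fun i => all (fun x => x < m) (op_heads (iop i)) &&
                if iop i is Init then false else true) code.

Lemma machine_run n c c' : code_ok -> bounded w c.2 -> run w code n c c' ->
  exists2 t, t <= n * N.*2.+2 &
    iter t (@tm_step machine) (mconfig c.1 c.2) = mconfig c'.1 c'.2.
Proof.
move=> ok bs rn; elim: rn bs => {n c c'} [c|n pc s o t f c Hpc _ IH] bs.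
  by exists 0.
have /andP[Ho /= HI] : all (fun x => x < m) (op_heads o) && if o is Init then false else true.
  have pcL : pc < size code by rewrite -onthTE Hpc.
  have := all_nthP (Ins Init 0 0) ok pc pcL.
  by rewrite (onth_nth _ _ _ _ Hpc).
have [|t1 le1 H1] := machine_instr Hpc bs Ho; first by move=> o0; rewrite o0 in HI.
have [|t2 le2 H2] := IH; first exact: op_store_bounded.
by exists (t2 + t1); [lia | rewrite iterD H1 H2].
Qed.

End Machine.

(** * Formulas with counting quantifiers *)

(* Variables are de Bruijn indices.  Quantified variables range over the
   positions of the word; [FCnt y p] says that exactly [y] positions satisfy [p]. *)
Inductive form :=
  | FRead of nat & Sym
  | FLt of nat & nat
  | FEq of nat & nat
  | FNot of form
  | FAnd of form & form
  | FEx of form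
  | FCnt of nat & form.

Fixpoint sat (w : seq Sym) (e : seq nat) (p : form) : bool :=
  match p with
  | FRead x a => onth w (nth 0 e x) == Some a
  | FLt x y => nth 0 e x < nth 0 e y
  | FEq x y => nth 0 e x == nth 0 e y
  | FNot q => ~~ sat w e q
  | FAnd q r => sat w e q && sat w e r
  | FEx q => has (fun v => sat w (v :: e) q) (iota 0 (size w))
  | FCnt y q =>
      nth 0 e y == count (fun v => sat w (v :: e) q) (iota 0 (size w))
  end.

(* At depth [d] the head of index [x] is the odd number [2 (d - x) - 1]; head
   [0] never moves and represents the value [0] of the indices [x >= d].  The
   even heads hold the counters. *)
Definition hv (d x : nat) : nat := (d - x).*2.-1.

Fixpoint len (p : form) : nat :=
  match p with
  | FRead _ _ | FLt _ _ | FEq _ _ => 1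
  | FNot q => len q
  | FAnd q r => len q + len r
  | FEx q => (len q).+3
  | FCnt _ q => (len q).+4.+2
  end.

(** Code for [p] below [d] quantifiers, to be placed at address [b]; it leaves to [t] if [p] holds
    and to [f] otherwise. Negation thus only swaps the exits, and an existential loop leaves at its
    first success. *)
Fixpoint comp (p : form) (d b t f : nat) : seq instr :=
  match p with
  | FRead x a => [:: Ins (Read (hv d x) (Some a)) t f]
  | FLt x y => [:: Ins (Lt (hv d x) (hv d y)) t f]
  | FEq x y => [:: Ins (Eql (hv d x) (hv d y)) t f]
  | FNot q => comp q d b f t
  | FAnd q r => comp q d b (b + len q) f ++ comp r d (b + len q) t f
  | FEx q =>
      let x := d.*2.+1 in
      [:: Ins (Zero x) b.+1 b.+1; Ins (Read x None) f b.+2] ++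
      comp q d.+1 b.+2 t (b.+2 + len q) ++ [:: Ins (Inc x) b.+1 b.+1]
  | FCnt y q =>
      let x := d.*2.+1 in let z := d.*2.+2 in let b' := b.+3 + len q in
      [:: Ins (Zero x) b.+1 b.+1; Ins (Zero z) b.+2 b.+2;
          Ins (Read x None) b'.+2 b.+3] ++
      comp q d.+1 b.+3 b' b'.+1 ++
      [:: Ins (Inc z) b'.+1 b'.+1; Ins (Inc x) b.+2 b.+2;
          Ins (Eql z (hv d y)) t f]
  end.

Fixpoint cost (p : form) (N : nat) : nat :=
  match p with
  | FRead _ _ | FLt _ _ | FEq _ _ => 1
  | FNot q => cost q N
  | FAnd q r => cost q N + cost r N
  | FEx q => N * (cost q N + 2) + 2
  | FCnt _ q => N * (cost q N + 3) + 4
  end.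

Fixpoint height (p : form) : nat :=
  match p with
  | FRead _ _ | FLt _ _ | FEq _ _ => 0
  | FNot q => height q
  | FAnd q r => maxn (height q) (height r)
  | FEx q | FCnt _ q => (height q).+1
  end.

Lemma size_comp p d b t f : size (comp p d b t f) = len p.
Proof.
elim: p d b t f => //= [q IHq r IHr|q IHq|y q IHq] d b t f;
  by rewrite !size_cat ?IHq ?IHr //=; lia.
Qed.

Lemma comp_ok p m d b t f : (d + height p).*2 < m -> code_ok m (comp p d b t f).
Proof.
rewrite /code_ok.
elim: p d b t f => //= [x a|x y|x y|q IHq|q IHq r IHr|q IHq|y q IHq] d b t f H.
- by rewrite !andbT /hv; lia.
- by rewrite !andbT /hv; apply/andP; lia.
- by rewrite !andbT /hv; apply/andP; lia.
- exact: IHq.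
- by rewrite all_cat IHq ?IHr //; lia.
- by rewrite all_cat IHq /= ?andbT; rewrite ?andbT; lia.
- by rewrite all_cat IHq /= /hv ?andbT; lia.
Qed.

Definition code_at (code : seq instr) (b : nat) (c : seq instr) :=
  forall i, i < size c -> onth code (b + i) = onth c i.

Lemma code_at_cat code b c1 c2 : code_at code b (c1 ++ c2) ->
  code_at code b c1 /\ code_at code (b + size c1) c2.
Proof.
move=> H; split=> i Hi.
  by rewrite H ?size_cat ?ltn_addr // onth_cat Hi.
by rewrite -addnA H ?size_cat ?ltn_add2l // onth_cat ltnNge leq_addr /= addKn.
Qed.

Lemma code_at_cons code b i c : code_at code b (i :: c) ->
  onth code b = Some i /\ code_at code b.+1 c.
Proof.
move=> /(@code_at_cat code b [:: i] c)[/(_ 0 isT) + H]; rewrite addn0 addn1 in H *.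
by [].
Qed.

Lemma upd_eq s x v : upd s x v x = v. Proof. by rewrite /upd eqxx. Qed.
Lemma upd_neq s x v y : y != x -> upd s x v y = s y.
Proof. by rewrite /upd => /negbTE->. Qed.

(** * Correctness and cost of the compiled code *)

Section Correctness.
Variables (w : seq Sym) (code : seq instr).
Let N := size w.

(** The protected heads at depth [d]: head [0], and the variables and counters of the [d] enclosing
    quantifiers. *)
Definition agree (d : nat) (s' s : store) := forall h, h < d.*2.+1 -> s' h = s h.

Definition stores (d : nat) (e : seq nat) (s : store) :=
  forall x, s (hv d x) = nth 0 e x.

Lemma stores_agree d e s s' : agree d s' s -> stores d e s -> stores d e s'.
Proof. by move=> A H x; rewrite -H A // /hv; lia. Qed.

Lemma stores_cons d e s : stores d e s -> stores d.+1 (s d.*2.+1 :: e) s.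
Proof. by move=> H [|x]; rewrite /= -?H /hv ?subSS. Qed.

Definition reaches (n : nat) (d : nat) (pc : nat) (s : store) (pc' : nat) :=
  exists n' s', [/\ n' <= n, run w code n' (pc, s) (pc', s'), bounded w s'
    & agree d s' s].

(** Induction on [p]. Each loop is treated by induction on the number [k] of positions left; its own
    head and counter survive the body because they are protected at depth [d.+1]. *)
Lemma comp_run p d e s b t f : code_at code b (comp p d b t f) ->
  bounded w s -> stores d e s ->
  reaches (cost p N) d b s (if sat w e p then t else f).
Proof.
elim: p d e s b t f => [x a|x y|x y|q IHq|q IHq r IHr|q IHq|y q IHq] d e s b t f /=.
- move=> /code_at_cons[Hb _] bs es; exists 1, s; split=> //.
  by apply: runS Hb _ => /=; rewrite es; exact: run0.
- move=> /code_at_cons[Hb _] bs es; exists 1, s; split=> //.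
  by apply: runS Hb _ => /=; rewrite !es; exact: run0.
- move=> /code_at_cons[Hb _] bs es; exists 1, s; split=> //.
  by apply: runS Hb _ => /=; rewrite !es; exact: run0.
- by move=> /IHq H bs es; have := H _ _ bs es; case: (sat w e q).
- move=> /code_at_cat[/IHq Hq]; rewrite size_comp => /IHr Hr bs es.
  have [n1 [s1 [le1 r1 bs1 A1]]] := Hq _ _ bs es.
  case: ifP r1 => sq r1 /=; last by exists n1, s1; split=> //; lia.
  have [n2 [s2 [le2 r2 bs2 A2]]] := Hr _ _ bs1 (stores_agree A1 es).
  exists (n1 + n2), s2; split=> //; [lia | exact: run_cat r1 r2 |].
  by move=> h Hh; rewrite A2 // A1.
- set x := d.*2.+1.
  move=> /code_at_cons[H0] /code_at_cons[H1] /code_at_cat[/IHq Hq].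
  rewrite size_comp => /code_at_cons[H2 _] bs es.
  have loop k s1 : k = N - s1 x -> bounded w s1 -> stores d e s1 ->
    reaches (k * (cost q N + 2) + 1) d b.+1 s1
      (if has (fun v => sat w (v :: e) q) (iota (s1 x) k) then t else f).
    elim: k s1 => [|k IH] s1 Ek bs1 es1.
      exists 1, s1; split=> //; apply: runS H1 _ => /=.
      by rewrite onth_None -/N (_ : N <= s1 x) ?run0 //; first exact: run0; lia.
    have [n1 [s2 [le1 r1 bs2 A1]]] := Hq _ _ bs1 (stores_cons es1).
    have {}r1 : run w code n1.+1 (b.+1, s1)
        ((if sat w (s1 x :: e) q then t else b.+2 + len q), s2).
      by apply: runS H1 _ => /=; rewrite onth_None -/N leqNgt (_ : s1 x < N) //; lia.
    rewrite /=; case: ifP r1 => sq r1.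
      exists n1.+1, s2; split=> //; first lia.
      by move=> h Hh; rewrite A1 //; lia.
    have s2x : s2 x = s1 x by apply: A1; lia.
    pose s3 := upd s2 x (minn (s2 x).+1 N).
    have A3 : agree d s3 s1.
      by move=> h Hh; rewrite /s3 upd_neq ?A1 //; rewrite /x; lia.
    have s3x : s3 x = (s1 x).+1 by rewrite /s3 upd_eq s2x; lia.
    have [||n2 [s4 [le4 r4 bs4 A4]]] := IH s3 _ (@op_store_bounded _ (Inc x) _ bs2).
    + by rewrite s3x; lia.
    + exact: stores_agree A3 es1.
    rewrite s3x in r4; exists (n1.+1 + n2.+1), s4; split=> //; first lia.
      by apply: run_cat r1 _; apply: runS H2 r4.
    by move=> h Hh; rewrite A4 // A3.
  have A0 : agree d (upd s x 0) s by move=> h Hh; rewrite upd_neq // /x; lia.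
  have := loop N _ _ (@op_store_bounded _ (Zero x) _ bs) (stores_agree A0 es).
  rewrite /= upd_eq subn0 => /(_ erefl)[n [s' [le r bs' A]]].
  exists n.+1, s'; split=> //; first lia.
    by apply: runS H0 r.
  by move=> h Hh; rewrite A // A0.
- set x := d.*2.+1; set z := d.*2.+2; set b' := _ + len q.
  move=> /code_at_cons[H0] /code_at_cons[H1] /code_at_cons[H2] /code_at_cat[/IHq Hq].
  rewrite size_comp => /code_at_cons[H3] /code_at_cons[H4] /code_at_cons[H5 _] bs es.
  (* The invariant [s1 z <= s1 x] keeps the counter below [N] whenever it is incremented, so the cap
     of [Inc] never falsifies the count. *)
  have loop k s1 : k = N - s1 x -> s1 z <= s1 x -> bounded w s1 -> stores d e s1 ->
    exists n' s', [/\ n' <= k * (cost q N + 3) + 1,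
      run w code n' (b.+2, s1) (b'.+2, s'), bounded w s', agree d s' s1 &
      s' z = s1 z + count (fun v => sat w (v :: e) q) (iota (s1 x) k)].
    elim: k s1 => [|k IH] s1 Ek zx bs1 es1.
      exists 1, s1; split=> //; last by rewrite addn0.
      apply: runS H2 _ => /=.
      by rewrite onth_None -/N (_ : N <= s1 x); first exact: run0; lia.
    have [n1 [s2 [le1 r1 bs2 A1]]] := Hq _ _ bs1 (stores_cons es1).
    have {}r1 : run w code n1.+1 (b.+2, s1)
        ((if sat w (s1 x :: e) q then b' else b'.+1), s2).
      by apply: runS H2 _ => /=; rewrite onth_None -/N leqNgt (_ : s1 x < N) //; lia.
    have [n3 [s3 [le3 r3 bs3 A3 [s3x s3z]]]] : exists n3 s3, [/\ n3 <= n1.+2,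
        run w code n3 (b.+2, s1) (b'.+1, s3), bounded w s3, agree d s3 s1 &
        s3 x = s1 x /\ s3 z = sat w (s1 x :: e) q + s1 z].
      have s2x : s2 x = s1 x by apply: A1; lia.
      have s2z : s2 z = s1 z by apply: A1; lia.
      case: ifP r1 => _ r1.
        exists (n1.+1 + 1), (op_store w (Inc z) s2); split=> //; first lia.
        - by apply: run_cat r1 _; apply: runS H3 _; exact: run0.
        - exact: op_store_bounded.
        - by move=> h Hh; rewrite /= upd_neq ?A1 //; rewrite /z; lia.
        split; first by rewrite /= upd_neq // /x /z; lia.
        by rewrite /= upd_eq s2z; lia.
      exists n1.+1, s2; split=> //; first by move=> h Hh; rewrite A1 //; lia.
    pose s4 := op_store w (Inc x) s3.
    have A4 : agree d s4 s1.
      by move=> h Hh; rewrite /s4 /= upd_neq ?A3 //; rewrite /x; lia.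
    have s4x : s4 x = (s1 x).+1 by rewrite /s4 /= upd_eq s3x; lia.
    have s4z : s4 z = s3 z by rewrite /s4 /= upd_neq // /x /z; lia.
    have [||||n5 [s5 [le5 r5 bs5 A5 s5z]]] := IH s4.
    + by rewrite s4x; lia.
    + by rewrite s4x s4z s3z; case: (sat _ _ _); lia.
    + exact: op_store_bounded.
    + exact: stores_agree A4 es1.
    exists (n3 + n5.+1), s5; split=> //; first lia.
    + by apply: run_cat r3 _; apply: runS H4 r5.
    + by move=> h Hh; rewrite A5 // A4.
    + by rewrite s5z s4z s3z s4x /=; lia.
  pose s0 := op_store w (Zero z) (op_store w (Zero x) s).
  have A0 : agree d s0 s.
    by move=> h Hh; rewrite /s0 /= !upd_neq // /x /z; lia.
  have s0z : s0 z = 0 by rewrite /s0 /= upd_eq.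
  have s0x : s0 x = 0.
    by rewrite /s0 /= upd_neq ?upd_eq // /x /z; lia.
  have [||||n [s' [le r bs' A s'z]]] := loop N s0.
  + by rewrite s0x subn0.
  + by rewrite s0z.
  + by do 2! apply: op_store_bounded.
  + exact: stores_agree A0 es.
  have A' : agree d s' s by move=> h Hh; rewrite A // A0.
  exists (n.+2 + 1), s'; split=> //; first lia.
  have {}r : run w code n.+2 (b, s) (b'.+2, s').
    by apply: runS H0 _; apply: runS H1 _; exact: r.
  apply: run_cat r _; apply: runS H5 _ => /=.
  rewrite (stores_agree A' es) s'z s0z s0x add0n eq_sym; exact: run0.
Qed.

End Correctness.

(** * Polynomial running time *)

Definition poly_bounded (g : nat -> nat) :=
  exists c d, forall N, g N <= c * N ^ d + c.

Lemma poly_bounded_const a : poly_bounded (fun=> a).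
Proof. by exists a, 0 => N; lia. Qed.

Lemma poly_bounded_id : poly_bounded id.
Proof. by exists 1, 1 => N; rewrite expn1; lia. Qed.

(** The extra [1] is for [N = 0], where [0 ^ 0 = 1] exceeds the higher powers. *)
Lemma leq_expn1 N d d' : d <= d' -> N ^ d <= N ^ d' + 1.
Proof.
case: N => [|N] le; last by rewrite (leq_trans (leq_pexp2l _ le)) // leq_addr.
by case: d {le} => [|d]; [rewrite expn0 leq_addl | rewrite (exp0n (ltn0Sn d))].
Qed.

Lemma poly_bounded_add g h :
  poly_bounded g -> poly_bounded h -> poly_bounded (fun N => g N + h N).
Proof.
move=> [c [d Hg]] [c' [d' Hh]]; exists ((c + c').*2), (maxn d d') => N.
have := Hg N; have := Hh N.
have := leq_expn1 N (leq_maxl d d'); have := leq_expn1 N (leq_maxr d d').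
set D := N ^ maxn d d'; nia.
Qed.

Lemma poly_bounded_mul g h :
  poly_bounded g -> poly_bounded h -> poly_bounded (fun N => g N * h N).
Proof.
(* The product expands into four terms, each at most [c * c' * (N ^ (d + d') + 1)]. *)
move=> [c [d Hg]] [c' [d' Hh]]; exists ((c * c') * 4), (d + d') => N.
apply: leq_trans (leq_mul (Hg N) (Hh N)) _.
have := leq_expn1 N (leq_addr d' d); have := leq_expn1 N (leq_addl d d').
rewrite expnD; nia.
Qed.

Lemma poly_bounded_cost p : poly_bounded (cost p).
Proof.
elim: p => [x a|x y|x y|q IHq|q IHq r IHr|q IHq|y q IHq];
  do ?[exact: poly_bounded_const | exact: IHq | exact: IHr | exact: poly_bounded_id
      | apply: poly_bounded_add | apply: poly_bounded_mul].
Qed.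

(** Halting configurations are fixed by [tm_step], so a run can be padded to the exact polynomial
    number of steps. *)
Lemma tm_run_stable (M : TM) (w : seq Sym) n n' :
  let q := tm_state_of (tm_run M n w) in
  q = tm_acc M \/ q = tm_rej M -> n <= n' -> tm_run M n' w = tm_run M n w.
Proof.
move=> q Hq /subnK <-; elim: (n' - n) => [|i IH] //.
rewrite {1}/tm_run addSn iterS -/(tm_run M (i + n) w) IH.
move: Hq; rewrite /q /tm_state_of; case: (tm_run M n w) => [[q' l] r] /= [] ->;
  by rewrite /tm_step eqxx ?orbT.
Qed.

Theorem sat_poly_time (p : form) : exists (M : TM) (c d : nat),
  tm_acc M <> tm_rej M /\
  forall w, tm_state_of (tm_run M (c * size w ^ d + c) w) =
    if sat w [::] p then tm_acc M else tm_rej M.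
Proof.
(* The exits [L] and [L.+1], just past the code, are the counters of acceptance and rejection. *)
pose L := len p; pose code := comp p 0 0 L L.+1.
have sc : size code = L by exact: size_comp.
pose m := (height p).*2.+1; pose M := machine m code.
(* One sweep there and back per instruction, plus one for the initialisation. *)
have [c [d Hcd]] : poly_bounded (fun N => (cost p N + 1) * (2 * N + 2)).
  by do ?[exact: poly_bounded_const | exact: poly_bounded_cost | exact: poly_bounded_id
      | apply: poly_bounded_add | apply: poly_bounded_mul].
exists M, c, d; split.
  by case=> /(congr1 val); rewrite /= !inordK; lia.
move=> w.
have [n0 le0 r0] := machine_init m code w.
have bs0 : bounded w (fun=> 0) by [].
have [||n1 [s1 [le1 r1 _ _]]] := @comp_run w code p 0 [::] (fun=> 0) 0 L L.+1 _ bs0.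
- by [].
- by move=> x; rewrite nth_nil.
rewrite -sc in r1.
have [||n2 le2 r2] := machine_run (m := m) _ _ r1; [exact: comp_ok | by [] |].
have halt : tm_state_of (tm_run M (n2 + n0) w) =
    if sat w [::] p then tm_acc M else tm_rej M.
  by rewrite /tm_run iterD -/(tm_run M n0 w) r0 r2 /=; case: ifP.
rewrite (@tm_run_stable _ _ (n2 + n0)) //.
  by rewrite halt; case: ifP => _; [left | right].
apply: leq_trans (Hcd (size w)); nia.
Qed.

(** * Few mixed triangles suffice *)

(** Together with [uniq], this represents disjoint triangles by a flat list of vertices, read three
    at a time. *)
Fixpoint tri (T : Type) (r : rel T) (l : seq T) : bool :=
  match l with
  | [::] => true
  | [:: x, y, z & l'] => [&& r x y, r y z, r x z & tri r l']
  | _ => false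
  end.

Lemma seq3_ind (T : Type) (P : seq T -> Prop) :
  P [::] -> (forall x, P [:: x]) -> (forall x y, P [:: x; y]) ->
  (forall x y z l, P l -> P [:: x, y, z & l]) -> forall l, P l.
Proof.
move=> P0 P1 P2 P3; fix IH 1 => -[|x [|y [|z l]]];
  [exact: P0 | exact: P1 | exact: P2 | exact/P3/IH].
Qed.

Lemma tri_cat (T : Type) (r : rel T) l1 l2 :
  tri r l1 -> tri r l2 -> tri r (l1 ++ l2).
Proof.
move=> + t2; elim/seq3_ind: l1 => // x y z l IH /= /and4P[-> -> -> t1].
exact: IH.
Qed.

Lemma tri_clique (T : eqType) (r : rel T) (l : seq T) :
  uniq l -> {in l &, forall x y, x != y -> r x y} -> 3 %| size l -> tri r l.
Proof.
elim/seq3_ind: l => // x y z l IH; rewrite [uniq _]/= => /and4P[xl yl zl ul] rl.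
rewrite [size _]/= -(addn3 (size l)) dvdn_addl // => sl.
have [xy xz yz] : [/\ x != y, x != z & y != z].
  by move: xl yl; rewrite !inE !negb_or => /and3P[-> -> _] /andP[-> _].
rewrite /= !rl ?inE ?eqxx ?orbT //=; apply: IH => //.
by move=> u v ul' vl'; apply: rl; rewrite !inE ?ul' ?vl' !orbT.
Qed.

Section Triangles.
Variables (V : finType) (r : rel V) (k : nat) (lab : V -> 'I_k).
Hypothesis r_sym : symmetric r.
Hypothesis r_lab : forall x y, lab x = lab y -> x != y -> r x y.

Definition triangle (B : {set V}) :=
  #|B| = 3 /\ {in B &, forall x y, x != y -> r x y}.

Definition rest (l : seq V) (a : 'I_k) := #|[set v | (lab v == a) && (v \notin l)]|.

(** The uncovered vertices of a class form a clique of size divisible by 3, so listed in any order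
    they fall into triangles. They are appended class by class. *)
Lemma tri_complete l : uniq l -> tri r l -> (forall a, 3 %| rest l a) ->
  exists L, [/\ uniq L, tri r L & forall x, x \in L].
Proof.
move=> ul tl dl.
have ext (s : seq 'I_k) : uniq s -> exists L, [/\ uniq L, tri r L
    & forall x, (x \in L) = (x \in l) || (lab x \in s)].
  elim: s => [|a s IH] /=; first by exists l; split=> // x; rewrite orbF.
  case/andP=> as_ /IH[L [uL tL mL]].
  pose R := enum [set v | (lab v == a) && (v \notin l)].
  have mR x : (x \in R) = (lab x == a) && (x \notin l) by rewrite mem_enum inE.
  exists (L ++ R); split.
  - rewrite cat_uniq uL enum_uniq andbT /=; apply/hasPn=> x.
    by rewrite mR mL => /andP[/eqP-> /negbTE->] /=.
  - apply: tri_cat => //; apply: tri_clique; first exact: enum_uniq.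
      by move=> x y; rewrite !mR => /andP[/eqP lx _] /andP[/eqP ly _]; apply: r_lab; rewrite lx.
    by rewrite -cardE; apply: dl.
  - by move=> x; rewrite mem_cat mL mR inE; case: (x \in l); case: (_ == a); case: (_ \in s).
have [L [uL tL mL]] := ext _ (enum_uniq 'I_k).
by exists L; split=> // x; rewrite mL mem_enum orbT.
Qed.

Lemma tri_partition L : uniq L -> tri r L ->
  exists P : {set {set V}}, partition P [set x in L] /\ forall B, B \in P -> triangle B.
Proof.
elim/seq3_ind: L => // [_ _|x y z l IH].
  exists set0; split=> [|B]; last by rewrite inE.
  rewrite partition_set0 //; apply/eqP/setP=> x; by rewrite !inE.
rewrite [uniq _]/= !inE !negb_or -!andbA.
case/and5P=> xy xz xl yz /and3P[yl zl ul] /= /and4P[rxy ryz rxz tl].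
have [P [/and3P[/eqP cP tP nP] HP]] := IH ul tl.
pose B : {set V} := [set x; y; z].
have BP (A : {set V}) : A \in P -> [disjoint B & A].
  move=> AP; rewrite disjoint_subset; apply/subsetP=> u uB; rewrite inE /=.
  apply: contraL uB => uA.
  have : u \in cover P by apply/bigcupP; exists A.
  by rewrite cP !inE; apply: contraL => /orP[/orP[]|] /eqP->.
exists (B |: P); split; last first.
  move=> A; rewrite !inE => /predU1P[->|/HP//]; split.
    by rewrite /B setUC cardsU1 cards2 !inE negb_or eq_sym xz eq_sym yz xy.
  move=> u v; rewrite !inE => /orP[/orP[]|] /eqP-> /orP[/orP[]|] /eqP->;
    by rewrite ?eqxx // 1?r_sym // r_sym.
apply/and3P; split.
- rewrite /cover bigcup_setU big_set1 -/(cover P) cP; apply/eqP/setP=> u.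
  by rewrite !inE -!orbA.
- apply/trivIsetP=> A1 A2; rewrite !inE => /predU1P[->|A1P] /predU1P[->|A2P].
  + by rewrite eqxx.
  + by move=> _; exact: BP.
  + by move=> _; rewrite disjoint_sym; exact: BP.
  + exact: (trivIsetP tP).
- rewrite !inE negb_or nP andbT; apply/eqP=> /setP/(_ x).
  by rewrite !inE eqxx.
Qed.

Lemma blocks_tri (P : {set {set V}}) (bs : seq {set V}) :
  trivIset P -> (forall B, B \in P -> triangle B) -> uniq bs -> {subset bs <= P} ->
  exists l, [/\ uniq l, tri r l, size l = 3 * size bs
    & forall x, (x \in l) = has (fun B : {set V} => x \in B) bs].
Proof.
move=> tP HP; elim: bs => [|B bs IH] /=; first by exists [::].
case/andP=> Bbs ubs sub.
have [|l [ul tl sl ml]] := IH ubs; first by move=> A Abs; apply: sub; rewrite inE Abs orbT.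
have BP : B \in P by apply: sub; rewrite mem_head.
have [cB rB] := HP B BP.
exists (enum B ++ l); split.
- rewrite cat_uniq enum_uniq ul andbT /=; apply/hasPn=> x; rewrite ml => /hasP[A Abs xA].
  apply/negP; rewrite /= mem_enum => xB.
  have AB : B != A by apply: contraNneq Bbs => ->.
  have AP : A \in P by apply: sub; rewrite inE Abs orbT.
  have := trivIsetP tP _ _ BP AP AB; rewrite disjoints_subset => /subsetP/(_ _ xB).
  by rewrite inE xA.
- apply: tri_cat => //; apply: tri_clique; first exact: enum_uniq.
    by move=> x y; rewrite !mem_enum; exact: rB.
  by rewrite -cardE cB.
- by rewrite size_cat -cardE cB sl; lia.
- by move=> x; rewrite mem_cat ml mem_enum.
Qed.

(** A triangle has between 0 and 3 vertices in each class, hence ['I_4] and [4 ^ k] profiles. *)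
Definition profile := {ffun 'I_k -> 'I_4}.
Definition colour_count (B : {set V}) (a : 'I_k) := \sum_(x in B) (lab x == a).
Definition profile_of (B : {set V}) : profile := [ffun a => inord (colour_count B a)].

Lemma profile_ofE B a : triangle B -> profile_of B a = colour_count B a :> nat.
Proof.
case=> cB _; rewrite ffunE inordK // ltnS -cB -sum1_card.
by apply: leq_sum => x _; case: (_ == a).
Qed.

(* Three blocks with the same colour profile have together 0 mod 3 vertices of
   each colour, so a smallest set of blocks with the right residues contains at
   most two blocks of each profile. *)
Lemma few_blocks (P : {set {set V}}) : (forall B, B \in P -> triangle B) ->
  exists S : {set {set V}}, [/\ S \subset P, #|S| <= #|{: profile}| * 2
    & forall a, \sum_(B in S) colour_count B a = \sum_(B in P) colour_count B a %[mod 3]].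
Proof.
move=> HP.
pose Q (S : {set {set V}}) := (S \subset P) && [forall a,
  \sum_(B in S) colour_count B a == \sum_(B in P) colour_count B a %[mod 3]].
have QP : Q P by rewrite /Q subxx; apply/forallP.
case: (arg_minnP (fun S : {set {set V}} => #|S|) QP) => S /andP[SP /forallP QS] minS.
exists S; split=> //; last by move=> a; apply/eqP.
rewrite leqNgt; apply/negP=> big.
have [t Ht] : exists t : profile, 2 < #|[set B in S | profile_of B == t]|.
  apply/existsP; apply: contraLR big; rewrite negb_exists -leqNgt => /forallP small.
  rewrite -sum1_card (partition_big profile_of xpredT) //=.
  rewrite -sum_nat_const; apply: leq_sum => t _.
  have := small t; rewrite -leqNgt; apply: leq_trans.
  by rewrite -sum1_card; apply: eq_leq; apply: eq_bigl => B; rewrite inE.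
have [s [us ss /= subs]] := card_geqP Ht.
pose W := [set B in s].
have WS : W \subset S by apply/subsetP=> B; rewrite inE => /subs; rewrite inE => /andP[].
have cW : #|W| = 3 by rewrite cardsE -ss; apply/card_uniqP.
have sumW a : \sum_(B in W) colour_count B a = t a * 3.
  rewrite (eq_bigr (fun=> t a : nat)); first by rewrite sum_nat_const cW mulnC.
  move=> B; rewrite inE => /subs; rewrite inE => /andP[BS /eqP<-].
  by rewrite profile_ofE //; apply: HP; apply: (subsetP SP).
have : Q (S :\: W).
  rewrite /Q (subset_trans (subsetDl _ _) SP); apply/forallP=> a.
  rewrite -(eqP (QS a)) [X in _ == X %[mod 3]](big_setID W) /= (setIidPr WS).
  by rewrite sumW modnMDl.
move/minS; rewrite cardsD (setIidPr WS) cW.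
by have := subset_leq_card WS; rewrite cW; lia.
Qed.

(** Each class splits into the vertices covered by the kept blocks [S] and the rest. Since [P]
    covers the whole class and agrees with [S] modulo 3, the rest is 0 modulo 3. *)
Lemma few_tri (P : {set {set V}}) :
  partition P [set: V] -> (forall B, B \in P -> triangle B) ->
  exists l, [/\ uniq l, tri r l, size l <= 3 * (#|{: profile}| * 2)
    & forall a, 3 %| rest l a].
Proof.
move=> /and3P[/eqP cP tP _] HP.
have [S [SP cS HS]] := few_blocks HP.
have [||l [ul tl sl ml]] := blocks_tri (bs := enum S) tP HP.
- exact: enum_uniq.
- by move=> B; rewrite mem_enum; apply: (subsetP SP).
exists l; split=> //; first by rewrite sl -cardE leq_mul2l cS.
move=> a; have tS := trivIsetS SP tP.
have mlS x : (x \in l) = (x \in cover S).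
  rewrite ml; apply/hasP/bigcupP=> -[B BS xB]; exists B => //;
    by rewrite ?mem_enum // -mem_enum.
have /eqP := HS a.
rewrite /colour_count -(big_trivIset _ tS) -(big_trivIset _ tP) /= cP.
rewrite [X in _ == X %[mod 3]](eq_bigl xpredT); last by move=> x; rewrite inE.
rewrite [X in _ == X %[mod 3]](bigID [in cover S]) /=.
rewrite -[X in X == _ %[mod _]]addn0 eqn_modDl mod0n eq_sym.
congr (3 %| _); rewrite /rest -sum1_card big_mkcond [RHS]big_mkcond /=.
by apply: eq_bigr => x _; rewrite !inE mlS andbC; case: (_ \in cover S); case: (_ == a).
Qed.

End Triangles.

(** * The formula for triangle partitions *)

Lemma count_iota_lt (Q : pred nat) p N : p <= N ->
  count (fun v => (v < p) && Q v) (iota 0 N) = count Q (iota 0 p).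
Proof.
move=> /subnKC <-; rewrite iotaD count_cat add0n.
rewrite (@eq_in_count _ _ Q (iota 0 p)); last by move=> v; rewrite mem_iota /= => ->.
rewrite (@eq_in_count _ _ pred0 (iota p _)) ?count_pred0 ?addn0 //.
by move=> v; rewrite mem_iota => /andP[pv _]; rewrite ltnNge pv.
Qed.

Lemma count_iota_ge a b : count (leq a) (iota 0 b) = b - a.
Proof. by elim: b => // b IH; rewrite -addn1 iotaD count_cat IH /=; lia. Qed.

Lemma has_iota_eq (Q : pred nat) v N :
  has (fun u => (u == v) && Q u) (iota 0 N) = (v < N) && Q v.
Proof.
apply/hasP/andP=> [[u]|[vN Qv]]; last by exists v; rewrite ?mem_iota ?eqxx.
by rewrite mem_iota => /andP[_ uN] /andP[/eqP<-].
Qed.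

(** Addition by counting: [z = x + y] means that [x <= z] and exactly [y] positions lie in the
    interval from [x] to [z], with [x] included and [z] excluded. [FPlus1] excludes [x] too, which
    gives [z = x + y + 1]. *)
Definition FPlus x y z :=
  FAnd (FNot (FLt z x)) (FCnt y (FAnd (FLt 0 z.+1) (FNot (FLt 0 x.+1)))).

Definition FPlus1 x y z := FAnd (FLt x z) (FCnt y (FAnd (FLt 0 z.+1) (FLt x.+1 0))).

(** Constants come from the order alone: 0 has no position below it, and [a'.+1] is the immediate
    successor of [a']. *)
Fixpoint FConst a x :=
  if a is a'.+1 then
    FEx (FAnd (FConst a' 0) (FAnd (FLt 0 x.+1) (FNot (FEx (FAnd (FLt 1 0) (FLt 0 x.+2))))))
  else FNot (FEx (FLt 0 x.+1)).

Definition FTrue := FEq 0 0.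

Definition FSeg p g := FCnt g (FAnd (FLt 0 p.+1) (FRead 0 Sep)).

(** The offset of a position is the number of earlier positions in the same segment, so it is also
    obtained by counting. *)
Definition FAt g o a :=
  FEx (FAnd (FRead 0 a) (FAnd (FSeg 0 g.+1) (FCnt o.+1 (FAnd (FLt 0 1) (FSeg 0 g.+2))))).

Definition FAdj x y := FEx (FAnd (FPlus x.+1 x.+1 0) (FAt 0 y.+1 S1)).

Definition FCol a x :=
  FEx (FAnd (FPlus1 x.+1 x.+1 0) (FEx (FAnd (FConst a 0) (FAt 1 0 Sep)))).

Definition FNotIn x l := foldr (fun y p => FAnd (FNot (FEq x y)) p) FTrue l.

Fixpoint FUniq l := if l is x :: l' then FAnd (FNotIn x l') (FUniq l') else FTrue.

Fixpoint FTri l :=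
  match l with
  | [::] => FTrue
  | [:: x, y, z & l'] =>
      FAnd (FAdj x y) (FAnd (FAdj y z) (FAnd (FAdj x z) (FTri l')))
  | _ => FNot FTrue
  end.

(** Witnesses are [z] and [z + z] with [y = (z + z) + z]; both are positions if [y] is one. *)
Definition FDvd3 y := FEx (FEx (FAnd (FPlus 1 1 0) (FPlus 0 1 y.+2))).

(* Stated universally in the count, so that it holds for the empty word, where
   no position can carry the value 0. *)
Definition FRest T a :=
  FNot (FEx (FAnd (FCnt 0 (FAnd (FCol a 0) (FNotIn 0 (iota 2 T)))) (FNot (FDvd3 0)))).

Definition FCert k T :=
  FAnd (FUniq (iota 0 T))
    (FAnd (FTri (iota 0 T)) (foldr FAnd FTrue [seq FRest T a | a <- iota 0 k])).

(** A disjunction over the number [T <= C] of listed vertices, written as a negated conjunction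
    because [form] has no disjunction. *)
Definition FPartition k C :=
  FNot (foldr FAnd FTrue [seq FNot (iter T FEx (FCert k T)) | T <- iota 0 C.+1]).

Definition seg (w : seq Sym) p := count_mem Sep (take p w).

(* The separators cut the word into segments; [at_ w g o a] says that segment
   [g], with its closing separator, has the letter [a] at offset [o].  In an
   encoding, segment [2 x] is the adjacency row of vertex [x], and segment
   [2 x + 1] has its separator at the offset equal to the class of [x]. *)
Definition at_ (w : seq Sym) g o a :=
  has (fun p => [&& onth w p == Some a, g == seg w p &
                    o == count (fun u => g == seg w u) (iota 0 p)]) (iota 0 (size w)).

Lemma count_onth w (a : Sym) p :
  count (fun u => onth w u == Some a) (iota 0 p) = count_mem a (take p w).
Proof.
elim: w p => [|b w IH] p.
  by rewrite (@eq_count _ _ pred0) ?count_pred0 // => u; rewrite onth0n.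
case: p => [|p] //=.
by rewrite -(IH p) -[in iota 1 _](addn0 1) iotaDl count_map.
Qed.

Lemma seg_leq w p : seg w p <= p.
Proof. by rewrite /seg (leq_trans (count_size _ _)) // size_take_min geq_minl. Qed.

(** Makes it harmless that segment numbers and offsets are quantified over positions only. *)
Lemma at_bound w g o a : at_ w g o a -> (g < size w) && (o < size w).
Proof.
case/hasP=> p; rewrite mem_iota /= add0n => pN /and3P[_ /eqP-> /eqP->].
apply/andP; split; apply: leq_ltn_trans pN; first exact: seg_leq.
by rewrite (leq_trans (count_size _ _)) ?size_iota.
Qed.

(** * Meaning of the formulas on an arbitrary word *)

Section Sat.
Variable w : seq Sym.
Let N := size w.
Notation sat := (sat w).

(** The bound on [z] ensures that every number below it is a position and gets counted. *)
Lemma sat_plus e x y z : nth 0 e z <= N ->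
  sat e (FPlus x y z) = (nth 0 e z == nth 0 e x + nth 0 e y).
Proof.
move=> zN; rewrite /= count_iota_lt // (@eq_count _ _ (leq (nth 0 e x))).
  by rewrite count_iota_ge; lia.
by move=> v; rewrite -leqNgt.
Qed.

Lemma sat_plus1 e x y z : nth 0 e z <= N ->
  sat e (FPlus1 x y z) = (nth 0 e z == nth 0 e x + nth 0 e y + 1).
Proof.
move=> zN; rewrite /= count_iota_lt // (count_iota_ge (nth 0 e x).+1); lia.
Qed.

Lemma sat_const a e x : nth 0 e x <= N -> sat e (FConst a x) = (nth 0 e x == a).
Proof.
elim: a e x => [|a IH] e x xN.
  rewrite /= -[RHS]negbK -lt0n; congr (~~ _); apply/hasP/idP=> [[v _]|x0]; first by lia.
  by exists 0; rewrite ?mem_iota //; lia.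
set X := nth 0 e x in xN *.
pose gap y := (y < X) && ~~ has (fun v => y < v < X) (iota 0 N).
transitivity (has (fun y => (y == a) && gap y) (iota 0 N)).
  apply: eq_in_has => y; rewrite mem_iota => yN.
  by rewrite -[LHS]/(sat (y :: e) (FConst a 0) && gap y) IH //=; lia.
rewrite has_iota_eq; apply/and3P/eqP=> [[aN aX /hasPn nE]|Xa].
  apply/eqP; rewrite eqn_leq aX andbT leqNgt; apply/negP=> lt.
  (* If [X] exceeded [a.+1], then [a.+1] would be a position strictly between [a] and [X]. *)
  by have := nE a.+1; rewrite mem_iota lt ltnSn => /(_ ltac:(lia)).
by split; [lia | lia | apply/hasPn=> v _; lia].
Qed.

Lemma sat_at e g o a : sat e (FAt g o a) = at_ w (nth 0 e g) (nth 0 e o) a.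
Proof.
apply: eq_in_has => p; rewrite mem_iota /= add0n => pN.
rewrite !count_iota_lt ?(ltnW pN) // count_onth; congr [&& _, _ & _ == _].
apply: eq_in_count => u; rewrite mem_iota /= add0n => up.
by rewrite count_iota_lt ?count_onth //; lia.
Qed.

Definition adj_at x y := at_ w (x + x) y S1.
Definition col_at a x := at_ w (x + x + 1) a Sep.

Lemma sat_adj e x y : sat e (FAdj x y) = adj_at (nth 0 e x) (nth 0 e y).
Proof.
rewrite /adj_at; set X := nth 0 e x; set Y := nth 0 e y.
transitivity (has (fun g => (g == X + X) && at_ w g Y S1) (iota 0 N)).
  apply: eq_in_has => g; rewrite mem_iota => gN.
  by rewrite -[LHS]/(sat _ (FPlus _ _ _) && sat _ (FAt _ _ _)) sat_plus ?sat_at //=; lia.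
rewrite has_iota_eq; apply: andb_idl => /at_bound; by case/andP.
Qed.

Lemma sat_col a e x : sat e (FCol a x) = col_at a (nth 0 e x).
Proof.
rewrite /col_at; set X := nth 0 e x.
transitivity (has (fun g => (g == X + X + 1) && at_ w g a Sep) (iota 0 N)).
  apply: eq_in_has => g; rewrite mem_iota => gN.
  rewrite -[LHS]/(sat (g :: e) (FPlus1 x.+1 x.+1 0) &&
                  sat (g :: e) (FEx (FAnd (FConst a 0) (FAt 1 0 Sep)))).
  rewrite sat_plus1; last by rewrite /=; lia.
  congr (_ && _); transitivity (has (fun o => (o == a) && at_ w g o Sep) (iota 0 N)).
    apply: eq_in_has => o; rewrite mem_iota => oN.
    by rewrite -[LHS]/(sat _ (FConst _ _) && sat _ (FAt _ _ _)) sat_const ?sat_at //=; lia.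
  by rewrite has_iota_eq; apply: andb_idl => /at_bound; case/andP.
by rewrite has_iota_eq; apply: andb_idl => /at_bound; case/andP.
Qed.

Lemma sat_notin e x l : sat e (FNotIn x l) = (nth 0 e x \notin map (nth 0 e) l).
Proof. by elim: l => [|y l IH] //=; rewrite ?eqxx // inE negb_or IH. Qed.

Lemma sat_uniq e l : sat e (FUniq l) = uniq (map (nth 0 e) l).
Proof. by elim: l => [|x l IH] /=; rewrite ?eqxx // sat_notin IH. Qed.

Lemma sat_tri e l : sat e (FTri l) = tri adj_at (map (nth 0 e) l).
Proof.
elim/seq3_ind: l => [|x|x y|x y z l IH]; try by rewrite /= eqxx.
rewrite -[LHS]/([&& sat e (FAdj x y), sat e (FAdj y z), sat e (FAdj x z) & sat e (FTri l)]).
by rewrite !sat_adj IH.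
Qed.

Lemma sat_foldr_and e ps : sat e (foldr FAnd FTrue ps) = all (sat e) ps.
Proof. by elim: ps => [|p ps IH] /=; rewrite ?eqxx // IH. Qed.

Lemma sat_dvd3 e y : nth 0 e y < N -> sat e (FDvd3 y) = (3 %| nth 0 e y).
Proof.
move=> yN; rewrite -[LHS]/(has (fun z => has (fun t =>
  sat [:: t, z & e] (FPlus 1 1 0) && sat [:: t, z & e] (FPlus 0 1 y.+2)) (iota 0 N)) (iota 0 N)).
apply/hasP/dvdnP=> [[z]|[z Ez]].
  rewrite mem_iota => zN /hasP[t]; rewrite mem_iota => tN.
  rewrite !sat_plus /=; [|lia|lia].
  by case/andP=> /eqP-> /eqP->; exists z; lia.
exists z; first by rewrite mem_iota; lia.
apply/hasP; exists (z + z); first by rewrite mem_iota; lia.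
rewrite !sat_plus /=; [|lia|lia].
by rewrite eqxx Ez /=; lia.
Qed.

Lemma map_nth_iota (l e : seq nat) : map (nth 0 (l ++ e)) (iota 0 (size l)) = l.
Proof.
apply: (@eq_from_nth _ 0); rewrite size_map size_iota // => i il.
by rewrite (nth_map 0) ?size_iota // nth_iota // nth_cat il.
Qed.

Definition nrest (l : seq nat) a :=
  count (fun v => col_at a v && (v \notin l)) (iota 0 N).

(** The quantifier can only meet the count if the count is a position; on the empty word the count
    is 0 and both sides hold. *)
Lemma sat_rest l a : (N = 0) \/ (nrest l a < N) ->
  sat l (FRest (size l) a) = (3 %| nrest l a).
Proof.
move=> HN.
transitivity (~~ has (fun y => (y == nrest l a) && ~~ (3 %| y)) (iota 0 N)).
  congr (~~ _); apply: eq_in_has => y; rewrite mem_iota => yN.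
  rewrite -[LHS]/((y == count (fun v => sat [:: v, y & l] (FCol a 0) &&
    sat [:: v, y & l] (FNotIn 0 (iota 2 (size l)))) (iota 0 N)) && ~~ sat (y :: l) (FDvd3 0)).
  rewrite sat_dvd3 //; congr ((_ == _) && _); apply: eq_count => v.
  rewrite sat_col sat_notin.
  suff -> : map (nth 0 [:: v, y & l]) (iota 2 (size l)) = l by [].
  by rewrite (iotaDl 2 0) -map_comp -[RHS](map_nth_iota l [::]) cats0.
rewrite has_iota_eq negb_and negbK; case: HN => [N0|->] //.
by rewrite /nrest N0.
Qed.

(** The outermost quantifier binds the last entry of [l], so the induction extends the list at its
    end. *)
Lemma sat_exs T p e : reflect
  (exists l, [/\ size l = T, all (fun v => v < N) l & sat (l ++ e) p])
  (sat e (iter T FEx p)).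
Proof.
elim: T e => [|T IH] e.
  apply: (iffP idP) => [H|[l [/size0nil-> _]]] //; by exists [::].
apply: (iffP hasP) => [[v]|[l []]].
  rewrite mem_iota => /andP[_ vN] /IH[l [sl al Hl]]; exists (rcons l v).
  by rewrite size_rcons sl all_rcons al vN cat_rcons.
case/lastP: l => // l v; rewrite size_rcons all_rcons cat_rcons => -[sl] /andP[vN al] H.
exists v; first by rewrite mem_iota.
by apply/IH; exists l.
Qed.

Lemma sat_partition k C : (forall l a, N = 0 \/ nrest l a < N) ->
  reflect (exists l, [/\ size l <= C, all (fun v => v < N) l, uniq l, tri adj_at l
             & forall a, a < k -> 3 %| nrest l a])
    (sat [::] (FPartition k C)).
Proof.
move=> HN.
have certE l : sat l (FCert k (size l)) =
    [&& uniq l, tri adj_at l & all (fun a => 3 %| nrest l a) (iota 0 k)].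
  have El : map (nth 0 l) (iota 0 (size l)) = l by rewrite -[in nth 0 l](cats0 l) map_nth_iota.
  rewrite -[LHS]/([&& sat _ _, sat _ _ & sat _ _]) sat_uniq sat_tri sat_foldr_and El.
  by rewrite all_map; congr [&& _, _ & _]; apply: eq_all => a /=; rewrite -sat_rest.
rewrite -[sat _ _]/(~~ sat [::] (foldr FAnd FTrue
  [seq FNot (iter T FEx (FCert k T)) | T <- iota 0 C.+1])) sat_foldr_and all_map -has_predC.
apply: (iffP hasP) => [[T]|[l [sl al ul tl dl]]].
  rewrite mem_iota ltnS => /andP[_ TC] /= /negPn/sat_exs[l [sl al]].
  rewrite cats0 -sl certE => /and3P[ul tl /allP dl]; exists l; split=> //; first by rewrite sl.
  by move=> a ak; apply: dl; rewrite mem_iota.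
exists (size l); first by rewrite mem_iota ltnS.
apply/negPn/sat_exs; exists l; split=> //; rewrite cats0 certE ul tl.
by apply/allP=> a; rewrite mem_iota => /andP[_]; exact: dl.
Qed.

End Sat.

(** * The encoding of a graph *)

Section Block.
Variables (b w : seq Sym).
Hypothesis bSep : Sep \notin b.

Lemma seg_low p : p <= size b -> seg (rcons b Sep ++ w) p = 0.
Proof.
move=> pb; rewrite /seg cat_rcons takel_cat //.
by apply/count_memPn; apply: contra bSep; apply: mem_take.
Qed.

Lemma seg_high p : seg (rcons b Sep ++ w) ((size b).+1 + p) = (seg w p).+1.
Proof.
rewrite /seg take_cat size_rcons ltnNge leq_addr /= addKn count_cat -cats1 count_cat.
by rewrite (count_memPn bSep).
Qed.

Lemma at_block0 o a : at_ (rcons b Sep ++ w) 0 o a = (onth (rcons b Sep) o == Some a).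
Proof.
rewrite /at_ size_cat size_rcons iotaD has_cat.
rewrite [X in _ || X](_ : _ = false) ?orbF; last first.
  apply/negbTE/hasPn=> p; rewrite mem_iota => /andP[pb _]; rewrite -(subnKC pb) seg_high.
  by rewrite andbF.
transitivity (has (fun p => (p == o) && (onth (rcons b Sep) p == Some a)) (iota 0 (size b).+1)).
  apply: eq_in_has => p; rewrite mem_iota => /andP[_ pb].
  rewrite onth_cat size_rcons pb seg_low //= andbC (@eq_in_count _ _ predT).
    by rewrite count_predT size_iota eq_sym.
  by move=> u; rewrite mem_iota => /andP[_ up]; rewrite seg_low //; lia.
rewrite has_iota_eq; apply: andb_idl => /eqP oa.
by rewrite -(size_rcons b Sep) -onthTE oa.
Qed.

(** A leading block raises later segment numbers by one and leaves offsets alone, since its own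
    positions lie in segment 0 and are not counted. *)
Lemma at_blockS g o a : at_ (rcons b Sep ++ w) g.+1 o a = at_ w g o a.
Proof.
have low p : p <= size b -> g.+1 == seg (rcons b Sep ++ w) p = false.
  by move=> pb; rewrite seg_low.
have shift m : iota (0 + (size b).+1) m = map (addn (size b).+1) (iota 0 m).
  by rewrite -iotaDl addn0.
rewrite /at_ size_cat size_rcons iotaD has_cat.
rewrite [X in X || _](_ : _ = false) ?orFb; last first.
  apply/negbTE/hasPn=> p; rewrite mem_iota => /andP[_ pb].
  by rewrite low // andbF.
rewrite shift has_map; apply: eq_has => p.
pose v := rcons b Sep ++ w; pose q := (size b).+1 + p.
rewrite -[LHS]/([&& onth v q == Some a, g.+1 == seg v q
  & o == count (fun u => g.+1 == seg v u) (iota 0 q)]) /v /q.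
rewrite onth_cat size_rcons ltnNge leq_addr addKn seg_high eqSS.
congr [&& _, _ & _ == _]; rewrite iotaD count_cat shift.
rewrite (@eq_in_count _ _ pred0) ?count_pred0 ?add0n; last first.
  by move=> u; rewrite mem_iota => /andP[_ ub]; rewrite low.
rewrite count_map; apply: eq_count => u.
by rewrite -[LHS]/(g.+1 == seg (rcons b Sep ++ w) ((size b).+1 + u)) seg_high.
Qed.

End Block.

Section Rows.
Variables (I : Type) (A B : I -> seq Sym).
Hypotheses (ASep : forall i, Sep \notin A i) (BSep : forall i, Sep \notin B i).

Definition rows (s : seq I) := flatten [seq A i ++ Sep :: B i ++ [:: Sep] | i <- s].

Lemma rows_cons i s : rows (i :: s) = rcons (A i) Sep ++ rcons (B i) Sep ++ rows s.
Proof. by rewrite /rows /= !cat_rcons -catA /= -catA. Qed.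

Lemma at_even s x o a : at_ (rows s) (x + x) o a =
  if onth s x is Some i then onth (rcons (A i) Sep) o == Some a else false.
Proof.
elim: s x => [|i s IH] x; first by rewrite onth0n.
rewrite rows_cons; case: x => [|x]; first by rewrite at_block0.
by rewrite addnS addSn !at_blockS // IH.
Qed.

Lemma at_odd s x o a : at_ (rows s) (x + x + 1) o a =
  if onth s x is Some i then onth (rcons (B i) Sep) o == Some a else false.
Proof.
elim: s x => [|i s IH] x; first by rewrite onth0n.
rewrite rows_cons; case: x => [|x]; first by rewrite at_blockS // at_block0.
have -> : x.+1 + x.+1 + 1 = (x + x + 1).+2 by lia.
by rewrite !at_blockS // IH.
Qed.

End Rows.

Lemma onth_enum_ord n x : onth (enum 'I_n) x = insub x.
Proof.
case: insubP => [i xn <- /=|xn]; last by rewrite onth_default // size_enum_ord leqNgt.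
by rewrite onthE (nth_map i) ?size_enum_ord // nth_ord_enum.
Qed.

(** * The formula on encoded graphs *)

Section Graph.
Variables (n k : nat) (adj : rel 'I_n) (c : 'I_n -> 'I_k).
Let w := encode adj c.

Definition adj_row (i : 'I_n) := [seq if adj i j then S1 else S0 | j <- enum 'I_n].
Definition col_row (i : 'I_n) := nseq (c i) S1.

Lemma adj_row_Sep i : Sep \notin adj_row i.
Proof. by apply/mapP=> -[j _]; case: (adj i j). Qed.

Lemma col_row_Sep i : Sep \notin col_row i.
Proof. by rewrite mem_nseq andbF. Qed.

Lemma encodeE : w = rows adj_row col_row (enum 'I_n).
Proof. by []. Qed.

Definition lift_adj x y :=
  if insub x is Some i then if insub y is Some j then adj i j else false else false.

Lemma adj_atE x y : adj_at w x y = lift_adj x y.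
Proof.
rewrite /adj_at encodeE at_even; [|exact: adj_row_Sep|exact: col_row_Sep].
rewrite onth_enum_ord /lift_adj; case: insub => // i.
rewrite -cats1 onth_cat size_map size_enum_ord /adj_row onth_map onth_enum_ord.
case: insubP => [j -> _|/negbTE->] /=; first by case: (adj i j).
(* Offset [n] holds the closing separator, which is not [S1], and later offsets hold nothing. *)
by case: (y - n) => [|z] //=; rewrite onth0n.
Qed.

Lemma col_atE a x : col_at w a x = if insub x is Some i then c i == a :> nat else false.
Proof.
rewrite /col_at encodeE at_odd; [|exact: adj_row_Sep|exact: col_row_Sep].
rewrite onth_enum_ord; case: insub => // i.
rewrite -cats1 onth_cat size_nseq onth_nseq; case: ltnP => ca.
  by rewrite gtn_eqF.
case E: (a - c i) => [|z] /=; first by rewrite eqxx; apply/esym/eqP; lia.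
by rewrite onth0n; apply/esym/negbTE/eqP; lia.
Qed.

(** Each vertex contributes two separators. Hence vertices are positions, and for [n > 0] so is
    every number up to [n], in particular the counts of uncovered vertices. *)
Lemma size_encode : n + n <= size w.
Proof.
suff H s : size s + size s <= size (rows adj_row col_row s).
  by have := H (enum 'I_n); rewrite size_enum_ord encodeE.
elim: s => // i s IH.
by rewrite rows_cons !size_cat !size_rcons /=; lia.
Qed.

Lemma nrestE (l : seq 'I_n) (a : 'I_k) : nrest w (map val l) a = rest c l a.
Proof.
have nN : n <= size w by have := size_encode; lia.
transitivity (count (fun v => (v < n) && (col_at w a v && (v \notin map val l)))
  (iota 0 (size w))).
  by apply: eq_count => v; rewrite col_atE; case: insubP => [i -> _|/negbTE->].
rewrite count_iota_lt // -val_enum_ord count_map enumT /rest cardsE cardE /enum_mem size_filter.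
apply: eq_count => v.
by rewrite /= col_atE valK mem_map //; exact: val_inj.
Qed.

Lemma nrest_bound l a : size w = 0 \/ nrest w l a < size w.
Proof.
case: (posnP n) => [n0|n0]; [left|right].
  by rewrite encodeE; have /size0nil -> : size (enum 'I_n) = 0 by rewrite size_enum_ord.
have nN := size_encode.
apply: (@leq_ltn_trans n); last by lia.
rewrite -[n in _ <= n](size_iota 0) -count_predT -(@count_iota_lt predT n (size w)); last by lia.
apply: sub_count => v /=; rewrite col_atE andbT; case: insubP => // i -> _.
Qed.

Lemma tri_lift (l : seq 'I_n) : tri (adj_at w) (map val l) = tri adj l.
Proof.
elim/seq3_ind: l => //= x y z l ->.
by rewrite !adj_atE /lift_adj !valK.
Qed.

(** The formula quantifies over all positions, but [adj_at] holds only between vertices, and every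
    entry of a [tri] list belongs to a triangle. *)
Lemma tri_lift_surj l : tri (adj_at w) l -> exists l' : seq 'I_n, l = map val l'.
Proof.
elim/seq3_ind: l => // [_|x y z l IH] /=; first by exists [::].
case/and4P; rewrite !adj_atE /lift_adj.
case: insubP => // i _ <-; case: insubP => // j _ <- _; case: insubP => // h _ <- _ _ /IH[l' ->].
by exists [:: i, j, h & l'].
Qed.

(** The bound allows three vertices for each of at most two triangles per colour profile. One
    direction is [tri_complete] with [tri_partition], the other [few_tri]. *)
Lemma sat_encode : simple_graph adj -> classes_are_cliques adj c ->
  sat w [::] (FPartition k (3 * (#|{: profile k}| * 2))) <-> triangle_partitionable adj.
Proof.
move=> [adj_sym _] adj_c; split.
  case/(sat_partition _ _ nrest_bound) => l [_ _ ul tl dl].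
  have [l' El] := tri_lift_surj tl; rewrite {}El in ul tl dl.
  rewrite tri_lift in tl; rewrite (map_inj_uniq val_inj) in ul.
  have [|L [uL tL mL]] := @tri_complete _ adj k c adj_c l' ul tl.
    by move=> a; rewrite -nrestE; apply: dl.
  have [P [PP HP]] := tri_partition adj_sym uL tL.
  exists P; split=> //; suff <- : [set x in L] = [set: 'I_n] by [].
  by apply/setP=> x; rewrite !inE mL.
case=> P [PP HP].
have [l [ul tl sl dl]] := @few_tri _ adj k c P PP HP.
apply/(sat_partition _ _ nrest_bound); exists (map val l); split.
- by rewrite size_map.
- apply/allP=> _ /mapP[x _ ->]; have := size_encode; have := ltn_ord x; rewrite /=; lia.
- by rewrite (map_inj_uniq val_inj).
- by rewrite tri_lift.
- by move=> a ak; rewrite (nrestE l (Ordinal ak)).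
Qed.

End Graph.

Theorem mainTheorem15 :
  forall k : nat, exists (M : TM) (c d : nat),
    decides_triangle_partition_in_poly_time k M c d.
Proof.
move=> k.
(* The formula depends on [k] only, so one machine serves all graphs. *)
have [M [c [d [acc_rej HM]]]] := sat_poly_time (FPartition k (3 * (#|{: profile k}| * 2))).
exists M, c, d => n adj lab Hadj Hlab w q.
rewrite /q HM -(sat_encode Hadj Hlab); case: (sat _ _ _); split; [by left | by [] | by right |].
by split=> // /esym.
Qed.
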